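(* Let $c\in[0,1/2]$ satisfy $1-3c+\Big(1-\exp\big(-\frac{c(1-2c)}{(1-c)^2}\big)\Big)^2\ge 0$. Then on bipartite graphs (with any fractional matching and any arrival order), Algorithm 1 with parameter $c$ is a $c$-selectable OCRS. In particular, Algorithm 1 is $0.349$-selectable on bipartite graphs.
   Context: Let $G=(V,E)$ be a finite graph; $\partial(v)$ is the set of edges incident to $v$. A vector $\bm{x}\in[0,1]^E$ is a fractional matching if $\sum_{e\in\partial(v)}x_e\le 1$ for all $v$. Each edge $e$ is active independently with probability $x_e$. An online contention resolution scheme (OCRS) is given $G,\bm{x}$; edges are revealed one at a time in an order fixed in advance by an oblivious adversary; on arrival of $e$ it learns whether $e$ is active and irrevocably decides whether to select it; only active edges may be selected and selected edges must form a matching. An OCRS is $c$-selectable (on a class of graphs) if for every graph in the class, fractional matching and arrival order, every edge $e$ is selected with probability at least $cx_e$. An arriving edge $e=(u,v)$ is blocked if an already-selected edge is incident to $u$ or $v$. Algorithm 1 with parameter $c$: for each arriving edge $e$, let $\alpha_e:=c/\mathbb{P}[e\text{ not blocked}]$ (probability over activeness of earlier edges and the algorithm's earlier randomness), draw independent $A_e\sim\mathrm{Ber}(\alpha_e)$, and select $e$ iff $e$ is active, not blocked and $A_e=1$. It is well defined only if $\alpha_e\le1$ for every edge, in which case each edge is selected with probability exactly $cx_e$; ''$c$-selectable'' for this algorithm means $\alpha_e\le 1$ always holds on the class of inputs. *)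

(* Defs.v *)
From HB Require Import structures.
From mathcomp Require Import all_boot all_order all_algebra.
From mathcomp Require Import reals sequences bernoulli_distribution.
Set Implicit Arguments.
Unset Strict Implicit.
Unset Printing Implicit Defensive.
Import Order.TTheory GRing.Theory Num.Theory.
Local Open Scope ring_scope.

Record sgraph := SGraph {
  vtx : finType;
  edges : {set {set vtx}};
  edges_card2 : forall e, e \in edges -> #|e| = 2 }.

Definition edge (G : sgraph) : finType := {e : {set vtx G} | e \in edges G}.

Definition incident (G : sgraph) (v : vtx G) (e : edge G) : bool :=
  v \in val e.

Definition bipartite (G : sgraph) : Prop :=
  exists L : {set vtx G}, forall e : edge G,
    exists u v, [/\ u \in L, v \notin L & val e = [set u; v]].

Definition fractional_matching (R : realType) (G : sgraph) (x : edge G -> R) :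
    Prop :=
  (forall e, 0 <= x e <= 1) /\
  (forall v, \sum_(e : edge G | incident v e) x e <= 1).

Definition matching (G : sgraph) (M : {set edge G}) : Prop :=
  forall v, (#|[set e in M | incident v e]| <= 1)%N.

Definition blocked (G : sgraph) (M : {set edge G}) (e : edge G) : bool :=
  [exists f in M, [exists v, incident v e && incident v f]].

Definition arrival_order (G : sgraph) (s : seq (edge G)) : Prop :=
  perm_eq s (enum (edge G)).

(* The past of a run, in chronological order: each entry (e, a, z) records an
   arrived edge e, whether it was active (a) and whether it was selected (z). *)
Definition history (G : sgraph) : Type := seq (edge G * bool * bool).

Definition arrivals (G : sgraph) (h : history G) : seq (edge G) :=
  [seq t.1.1 | t <- h].
Definition active (G : sgraph) (h : history G) : {set edge G} :=
  [set e in [seq t.1.1 | t <- h & t.1.2]].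
Definition selected (G : sgraph) (h : history G) : {set edge G} :=
  [set e in [seq t.1.1 | t <- h & t.2]].

(* An online randomized scheme.  It knows G and x; when e arrives after the
   history h, it draws a fresh bit b ~ Ber(coin x h e) and selects e iff
   accept x h e a b, where a tells whether e is active.  It has no access to the
   order or to the activeness of later edges.  One bit per arrival is no
   restriction, since its bias may depend on the whole history. *)
Record scheme (R : realType) := Scheme {
  coin : forall G : sgraph, (edge G -> R) -> history G -> edge G -> R;
  accept : forall G : sgraph,
    (edge G -> R) -> history G -> edge G -> bool -> bool -> bool }.

(* Expectation of g over the history obtained by continuing the history h with
   the arrivals s: each arrival e draws, independently of the past, its
   activeness a ~ Ber(x e) and the bit b of the scheme. *)
Fixpoint expect_from (R : realType) (A : scheme R) (G : sgraph)
    (x : edge G -> R) (h : history G) (s : seq (edge G))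
    (g : history G -> R) : R :=
  if s is e :: s' then
    \sum_(a : bool) \sum_(b : bool)
      bernoulli_pmf (x e) a * bernoulli_pmf (coin A x h e) b *
      expect_from A x (rcons h (e, a, accept A x h e a b)) s' g
  else g h.

Definition prob (R : realType) (A : scheme R) (G : sgraph) (x : edge G -> R)
    (s : seq (edge G)) (ev : pred (history G)) : R :=
  expect_from A x [::] s (fun h => (ev h)%:R).

Inductive reachable (R : realType) (A : scheme R) (G : sgraph)
    (x : edge G -> R) : history G -> Prop :=
| Reach0 : reachable A x [::]
| ReachS h e a b : reachable A x h ->
    reachable A x (rcons h (e, a, accept A x h e a b)).

Definition ocrs_on (R : realType) (C : sgraph -> Prop) (A : scheme R) : Prop :=
  forall (G : sgraph) (x : edge G -> R) (s : seq (edge G)) (h : history G),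
    C G -> fractional_matching x -> arrival_order s ->
    reachable A x h -> prefix (arrivals h) s ->
    [/\ forall e, prefix (rcons (arrivals h) e) s -> 0 <= coin A x h e <= 1,
        selected h \subset active h
      & matching (selected h)].

Definition selectable_on (R : realType) (C : sgraph -> Prop) (c : R)
    (A : scheme R) : Prop :=
  forall (G : sgraph) (x : edge G -> R) (s : seq (edge G)),
    C G -> fractional_matching x -> arrival_order s ->
    forall e, c * x e <= prob A x s (fun h => e \in selected h).

Definition selectable_ocrs_on (R : realType) (C : sgraph -> Prop) (c : R)
    (A : scheme R) : Prop :=
  ocrs_on C A /\ selectable_on C c A.

Definition alg1_accept (R : realType) (G : sgraph) (x : edge G -> R)
    (h : history G) (e : edge G) (a b : bool) : bool :=
  [&& a, ~~ blocked (selected h) e & b].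

Definition prob_unblocked (R : realType) (A : scheme R) (G : sgraph)
    (x : edge G -> R) (s : seq (edge G)) (e : edge G) : R :=
  prob A x s (fun h => ~~ blocked (selected h) e).

(* The bias c / P[e not blocked] refers to the algorithm's own run on the
   earlier edges.  The recursion is solved by stages: alg1_stage c n has the
   right biases for the first n arrivals (see algorithm1_coinE). *)
Fixpoint alg1_stage (R : realType) (c : R) (n : nat) : scheme R :=
  if n is m.+1 then
    Scheme (fun G x h e =>
              c / prob_unblocked (alg1_stage c m) x (arrivals h) e)
           (@alg1_accept R)
  else Scheme (fun _ _ _ _ => 0) (@alg1_accept R).

Definition algorithm1 (R : realType) (c : R) : scheme R :=
  Scheme (fun G x h e => coin (alg1_stage c (size h).+1) x h e)
         (@alg1_accept R).

Definition alpha (R : realType) (c : R) (G : sgraph) (x : edge G -> R)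
    (s : seq (edge G)) (e : edge G) : R :=
  c / prob_unblocked (algorithm1 c) x s e.

(* Positivity of the denominator is required explicitly because c / 0 = 0. *)
Definition algorithm1_well_defined_on (R : realType) (C : sgraph -> Prop)
    (c : R) : Prop :=
  forall (G : sgraph) (x : edge G -> R) (s : seq (edge G)),
    C G -> fractional_matching x -> arrival_order s ->
    forall (p : seq (edge G)) (e : edge G), prefix (rcons p e) s ->
      0 < prob_unblocked (algorithm1 c) x p e /\ alpha c x p e <= 1.

Lemma expect_from_eq (R : realType) (A B : scheme R) (G : sgraph)
    (x : edge G -> R) (s : seq (edge G)) (h : history G)
    (g : history G -> R) :
  accept A = accept B ->
  (forall h' e, (size h' < size h + size s)%N ->
    coin A x h' e = coin B x h' e) ->
  expect_from A x h s g = expect_from B x h s g.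
Proof.
move=> eqacc; elim: s h => [//|e s IH] h eqcoin /=.
apply: eq_bigr => a _; apply: eq_bigr => b _.
rewrite eqcoin /= ?addnS ?ltnS ?leq_addr // eqacc IH // => h' e'.
by rewrite size_rcons addSnnS; apply: eqcoin.
Qed.

Lemma alg1_stage_coin (R : realType) (c : R) (G : sgraph) (x : edge G -> R)
    (m n : nat) (h : history G) (e : edge G) :
  (size h < m)%N -> (size h < n)%N ->
  coin (alg1_stage c m) x h e = coin (alg1_stage c n) x h e.
Proof.
have acc k : accept (alg1_stage c k) = @alg1_accept R by case: k.
elim: m n h e => [//|m IH] [//|n] h e; rewrite !ltnS => hm hn /=.
congr (_ / _); apply: expect_from_eq; first by rewrite !acc.
move=> h' e' /=; rewrite add0n size_map => lt.
by apply: IH; apply: leq_trans lt _.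
Qed.

Lemma algorithm1_coinE (R : realType) (c : R) (G : sgraph) (x : edge G -> R)
    (h : history G) (e : edge G) :
  coin (algorithm1 c) x h e = alpha c x (arrivals h) e.
Proof.
rewrite /alpha /=; congr (_ / _); apply: expect_from_eq => [|h' e'].
  by case: (size h).
rewrite add0n size_map => lt; exact: alg1_stage_coin.
Qed.

(* Main.v *)
(* Let Z be the random set of the edges e that are active and have A_e = 1. It
   contains every e independently with probability pi e = x_e alpha_e, and the
   set of selected edges is a function of Z. When e = (u, v) arrives after p,
   every earlier edge f has been selected with probability c x_f, so
     P[e not blocked] = 1 - c x_p(u) - c x_p(v) + P[u and v matched],
   with x_p(w) the total weight of the edges of p at w, and we need a lower
   bound on the last term. Call f = (u, w) sole for u if f is in Z and no edge
   at w arriving before f is; this forces u to be matched, and has probability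
   at least kappa x_f with kappa = c (1 - 2 c) / (1 - c)^2. For distinct f
   these events depend on disjoint sets of edges, because the vertices w lie
   on the same side, so u has a sole edge with probability at least
   1 - exp(- kappa x_p(u)). An edge on which both the event for u and that for v
   depend meets neither u nor v, and both events are decreasing in it; by
   Harris' inequality they are positively correlated. The resulting bound is
   nonincreasing in x_p(u) and x_p(v), and at x_p(u) = x_p(v) = 1 it is at
   least c by assumption. *)
Require Import Defs.
From mathcomp Require Import all_boot all_order all_algebra.
From mathcomp Require Import reals sequences.
From mathcomp Require Import bernoulli_distribution exp ring lra.
Set Implicit Arguments.
Unset Strict Implicit.
Unset Printing Implicit Defensive.
Import Order.TTheory GRing.Theory Num.Theory.
Local Open Scope ring_scope.

(** * Product measures on finite subsets: independence and correlation *)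

Section Mean.
Variables (R : realFieldType) (T : finType) (pi : T -> R).
Implicit Types (s : seq T) (F H : {set T} -> R) (e : T) (Z : {set T}).

(* Expectation of F over the random subset of s that contains each e
   independently with probability pi e. *)
Fixpoint mean s F : R :=
  if s is e :: s' then
    pi e * mean s' (fun Z => F (e |: Z))
    + (1 - pi e) * mean s' (fun Z => F (Z :\ e))
  else F set0.

(** [indep] and [decr] use the same two shifts of Z as the branches of [mean], so they compare these
    branches directly, with no assumption that e is absent from the rest of the list. *)
Definition indep F e := forall Z, F (e |: Z) = F (Z :\ e).
Definition decr F e := forall Z, F (e |: Z) <= F (Z :\ e).

Lemma eq_mean s F H : F =1 H -> mean s F = mean s H.
Proof.
elim: s F H => [|e s IH] F H FH /=; first exact: FH.
by congr (_ * _ + _ * _); apply: IH => Z; rewrite FH.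
Qed.

Lemma mean_const s a : mean s (fun=> a) = a.
Proof. by elim: s => //= e s ->; ring. Qed.

Lemma meanD s F H : mean s (fun Z => F Z + H Z) = mean s F + mean s H.
Proof. by elim: s F H => //= e s IH F H; rewrite !IH; ring. Qed.

Lemma meanZ s a F : mean s (fun Z => a * F Z) = a * mean s F.
Proof. by elim: s F => //= e s IH F; rewrite !IH; ring. Qed.

Lemma meanN s F : mean s (fun Z => - F Z) = - mean s F.
Proof.
rewrite -[RHS]mulN1r -meanZ; apply: eq_mean => Z; exact/esym/mulN1r.
Qed.

Lemma meanB s F H : mean s (fun Z => F Z - H Z) = mean s F - mean s H.
Proof. by rewrite meanD meanN. Qed.

Lemma mean_sum s (I : Type) (r : seq I) (P : pred I) (F : I -> {set T} -> R) :
  mean s (fun Z => \sum_(i <- r | P i) F i Z)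
  = \sum_(i <- r | P i) mean s (F i).
Proof.
elim: r => [|i r IH].
  by rewrite big_nil -[RHS](mean_const s); apply: eq_mean => Z; rewrite big_nil.
rewrite big_cons -IH; case: ifP => Pi; last first.
  by apply: eq_mean => Z; rewrite big_cons Pi.
by rewrite -meanD; apply: eq_mean => Z; rewrite big_cons Pi.
Qed.

Lemma ler_mean s F H : {in s, forall e, 0 <= pi e <= 1} ->
  (forall Z, F Z <= H Z) -> mean s F <= mean s H.
Proof.
elim: s F H => [|e s IH] F H pi01 FH /=; first exact: FH.
have /andP[pi0 pi1] := pi01 e (mem_head _ _).
have pi01' : {in s, forall e, 0 <= pi e <= 1}.
  by move=> f fs; apply: pi01; rewrite inE fs orbT.
by apply: lerD; apply: ler_wpM2l; rewrite ?subr_ge0 //; apply: IH.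
Qed.

Lemma indep_shift F e : indep F e ->
  forall Z, (F (e |: Z) = F Z) * (F (Z :\ e) = F Z).
Proof.
move=> Fe Z; case: (boolP (e \in Z)) => eZ.
  by rewrite -Fe; split; congr F; apply/setUidPr; rewrite sub1set.
by rewrite Fe; split; congr F; apply/setDidPl; rewrite disjoint_sym disjoints1.
Qed.

(** Stated for a relation r to serve equality ([indep_coord]) and order ([decr_coord]) at once.
    Distinct coordinates commute; for f = e both sides become the same set, whence the reflexivity
    hypothesis. *)
Lemma coord_shift (r : R -> R -> Prop) F e f : (forall a, r a a) ->
  (forall Z, r (F (f |: Z)) (F (Z :\ f))) ->
  (forall Z, r (F (e |: (f |: Z))) (F (e |: (Z :\ f)))) /\
  (forall Z, r (F ((f |: Z) :\ e)) (F ((Z :\ f) :\ e))).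
Proof.
move=> rr Fr; have [->|nfe] := eqVneq f e; split=> Z.
- have -> : e |: (Z :\ e) = e |: Z.
    by apply/setP => z; rewrite !inE; case: eqVneq.
  by rewrite setUA setUid.
- have -> : (e |: Z) :\ e = Z :\ e.
    by apply/setP => z; rewrite !inE; case: eqVneq.
  by rewrite setDDl setUid.
- have -> : e |: (Z :\ f) = (e |: Z) :\ f.
    apply/setP => z; rewrite !inE.
    by case: (eqVneq z f) => [->|] //=; rewrite (negPf nfe).
  by rewrite setUCA.
- have -> : (f |: Z) :\ e = f |: (Z :\ e).
    apply/setP => z; rewrite !inE.
    by case: (eqVneq z f) => [->|] //=; rewrite nfe.
  by have -> : Z :\ f :\ e = Z :\ e :\ f by rewrite !setDDl setUC.
Qed.

Lemma indep_coord F e f : indep F f ->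
  indep (fun Z => F (e |: Z)) f /\ indep (fun Z => F (Z :\ e)) f.
Proof. exact: (@coord_shift eq F e f (@erefl R)). Qed.

Lemma decr_coord F e f : decr F f ->
  decr (fun Z => F (e |: Z)) f /\ decr (fun Z => F (Z :\ e)) f.
Proof. exact: (@coord_shift (fun a b => a <= b) F e f (@lexx _ R)). Qed.

Lemma mean_catl s1 s2 F : {in s2, forall e, indep F e} ->
  mean (s1 ++ s2) F = mean s1 F.
Proof.
elim: s1 F => [|e s1 IH] F Fs2 /=.
  elim: s2 F Fs2 => [//|e s2 IH] F Fs2 /=.
  have Fe := indep_shift (Fs2 e (mem_head _ _)).
  have {}IH : mean s2 F = F set0.
    by apply: IH => f fs2; apply: Fs2; rewrite inE fs2 orbT.
  by rewrite !(@eq_mean s2 _ F) ?IH => [|Z|Z]; [ring|rewrite Fe..].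
by rewrite !IH // => f /Fs2 Ff; have [] := indep_coord e Ff.
Qed.

Lemma mean_mem s e : uniq s -> e \in s -> mean s (fun Z => (e \in Z)%:R) = pi e.
Proof.
elim: s => [//|f s IH] /= /andP[fs us]; rewrite inE.
have [->|nef /= es] := eqVneq e f.
  rewrite (@eq_mean s _ (fun=> 1)); last by move=> Z; rewrite !inE eqxx.
  rewrite [X in _ + _ * X](@eq_mean s _ (fun=> 0)); last first.
    by move=> Z; rewrite !inE eqxx.
  by move=> _; rewrite !mean_const; ring.
have eq1 : (fun Z => (e \in f |: Z)%:R : R) =1 (fun Z => (e \in Z)%:R).
  by move=> Z; rewrite !inE (negPf nef).
have eq2 : (fun Z => (e \in Z :\ f)%:R : R) =1 (fun Z => (e \in Z)%:R).
  by move=> Z; rewrite !inE nef.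
by rewrite (eq_mean _ eq1) (eq_mean _ eq2) IH //; ring.
Qed.

(* Harris' inequality, with coordinates on which only one of the two functions
   depends allowed to behave arbitrarily. *)
Lemma mean_corr s F H : {in s, forall e, 0 <= pi e <= 1} ->
  {in s, forall e, [\/ decr F e /\ decr H e, indep F e | indep H e]} ->
  mean s F * mean s H <= mean s (fun Z => F Z * H Z).
Proof.
elim: s F H => [//|e s IH] F H pi01 FH.
have /andP[pi0 pi1] := pi01 e (mem_head _ _).
have pi01' : {in s, forall e, 0 <= pi e <= 1}.
  by move=> f fs; apply: pi01; rewrite inE fs orbT.
have IH1 := IH (fun Z => F (e |: Z)) (fun Z => H (e |: Z)) pi01'.
have IH0 := IH (fun Z => F (Z :\ e)) (fun Z => H (Z :\ e)) pi01'.
move: IH1 IH0 => /=.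
set f1 := mean s _; set h1 := mean s _; set fh1 := mean s _.
set f0 := mean s _; set h0 := mean s _; set fh0 := mean s _ => IH1 IH0.
have {}IH1 : f1 * h1 <= fh1.
  apply: IH1 => f fs; have /FH : f \in e :: s by rewrite inE fs orbT.
  case=> [[/(decr_coord e)[? _] /(decr_coord e)[? _]]|/(indep_coord e)[? _]
    |/(indep_coord e)[? _]]; [exact: Or31|exact: Or32|exact: Or33].
have {}IH0 : f0 * h0 <= fh0.
  apply: IH0 => f fs; have /FH : f \in e :: s by rewrite inE fs orbT.
  case=> [[/(decr_coord e)[_ ?] /(decr_coord e)[_ ?]]|/(indep_coord e)[_ ?]
    |/(indep_coord e)[_ ?]]; [exact: Or31|exact: Or32|exact: Or33].
(* Conditioning on e adds the covariance term pi e * (1 - pi e) * (f1 - f0) * (h1 - h0). Both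
   differences are nonpositive if F and H decrease in e, and one of them vanishes if F or H ignores
   e. *)
have : 0 <= (f1 - f0) * (h1 - h0).
  case: (FH e (mem_head _ _)) => [[Fe He]|Fe|He].
  - by apply: mulr_le0; rewrite subr_le0; apply: ler_mean.
  - by rewrite /f1 (eq_mean _ Fe) subrr mul0r.
  - by rewrite /h1 (eq_mean _ He) subrr mulr0.
move=> fh; apply: (@le_trans _ _ (pi e * (f1 * h1) + (1 - pi e) * (f0 * h0))).
  rewrite -subr_ge0.
  have -> : pi e * (f1 * h1) + (1 - pi e) * (f0 * h0)
      - (pi e * f1 + (1 - pi e) * f0) * (pi e * h1 + (1 - pi e) * h0)
    = pi e * (1 - pi e) * ((f1 - f0) * (h1 - h0)) by ring.
  by rewrite mulr_ge0 ?fh // mulr_ge0 // subr_ge0.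
by apply: lerD; apply: ler_wpM2l; rewrite ?subr_ge0.
Qed.

(** When every coordinate is ignored by F or by H, [mean_corr] applies to - F as well as to F, and
    the two inequalities are opposite. *)
Lemma mean_indepM s F H : {in s, forall e, 0 <= pi e <= 1} ->
  {in s, forall e, indep F e \/ indep H e} ->
  mean s (fun Z => F Z * H Z) = mean s F * mean s H.
Proof.
move=> pi01 FH; apply/le_anti/andP; split; last first.
  by apply: mean_corr => // e /FH[Fe|He]; [apply: Or32|apply: Or33].
have : mean s (fun Z => - F Z) * mean s H <= mean s (fun Z => - F Z * H Z).
  apply: mean_corr => // e /FH[Fe|]; [apply: Or32 => Z|exact: Or33].
  by rewrite Fe.
rewrite [leRHS](@eq_mean s _ (fun Z => - (F Z * H Z))) => [|Z];
  last by rewrite mulNr.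
by rewrite !meanN mulNr lerN2.
Qed.
End Mean.

(** * Algorithm 1 as a greedy run on a random edge set *)

Section Run.
Variable G : sgraph.
Implicit Types (M Z : {set edge G}) (s p : seq (edge G)) (e : edge G).

(* The outcome of Algorithm 1 on the arrivals s as a deterministic function of
   the set Z of the edges e that are active and have A_e = 1. *)
Definition run M s Z : {set edge G} :=
  foldl (fun M e => if (e \in Z) && ~~ blocked M e then e |: M else M) M s.

Lemma run_cat M s1 s2 Z : run M (s1 ++ s2) Z = run (run M s1 Z) s2 Z.
Proof. exact: foldl_cat. Qed.

Lemma eq_run M s Z Z' : {in s, Z =i Z'} -> run M s Z = run M s Z'.
Proof.
elim: s M => [//|e s IH] M ZZ' /=; rewrite (ZZ' e) ?mem_head //.
by apply: IH => f fs; apply: ZZ'; rewrite inE fs orbT.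
Qed.

Lemma run_setU1 M s Z e : e \notin s -> run M s (e |: Z) = run M s Z.
Proof.
move=> es; apply: eq_run => f fs; rewrite !inE.
by case: eqVneq fs es => [->->|].
Qed.

Lemma run_setD1 M s Z e : e \notin s -> run M s (Z :\ e) = run M s Z.
Proof.
move=> es; apply: eq_run => f fs; rewrite !inE.
by case: eqVneq fs es => [->->|].
Qed.

Lemma mem_run_notin M s Z e : e \notin s -> (e \in run M s Z) = (e \in M).
Proof.
elim: s M => [//|f s IH] M; rewrite inE negb_or => /andP[nef es] /=.
by rewrite IH //; case: ifP => // _; rewrite !inE (negPf nef).
Qed.

Lemma sub_run M s Z : M \subset run M s Z.
Proof.
elim: s M => [|f s IH] M //=; apply: subset_trans (IH _).
by case: ifP => // _; exact: subsetUr.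
Qed.

Lemma run_subset s Z : run set0 s Z \subset Z.
Proof.
elim/last_ind: s => [|s e IH]; first exact: sub0set.
rewrite -cats1 run_cat /=; case: ifP => // /andP[eZ _].
by rewrite subUset sub1set eZ.
Qed.

Lemma run_mem s Z e : e \in run set0 s Z -> e \in s.
Proof. by apply: contraLR => es; rewrite mem_run_notin // inE. Qed.

Lemma mem_run_cons s1 s2 Z e : e \notin s1 -> e \notin s2 ->
  (e \in run set0 (s1 ++ e :: s2) Z)
  = (e \in Z) && ~~ blocked (run set0 s1 Z) e.
Proof.
move=> es1 es2; rewrite run_cat /= mem_run_notin //.
by case: ifP => _; rewrite ?mem_run_notin // !inE ?eqxx.
Qed.

Lemma matchingU1 M e : matching M -> ~~ blocked M e -> matching (e |: M).
Proof.
move=> mM nb v; have /card_le1_eqP Mv := mM v.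
have ne f : f \in M -> incident v e -> incident v f -> False.
  move=> fM ve vf; move/negP: nb; apply; apply/existsP; exists f.
  by rewrite fM; apply/existsP; exists v; rewrite ve vf.
apply/card_le1_eqP => f g; rewrite !inE.
move=> /andP[/orP[/eqP->|fM] vf] /andP[/orP[/eqP->|gM] vg] //.
- by case: (ne g).
- by case: (ne f).
- by apply: Mv; rewrite inE ?fM ?gM.
Qed.

Lemma matching0 : matching (set0 : {set edge G}).
Proof.
move=> v; rewrite (_ : [set _ in _ | _] = set0) ?cards0 //.
by apply/setP => e; rewrite !inE.
Qed.

Lemma matching_run s Z : matching (run set0 s Z).
Proof.
elim/last_ind: s => [|s e IH]; first exact: matching0.
rewrite -cats1 run_cat /=; case: ifP => // /andP[_]; exact: matchingU1.
Qed.

Lemma selected_rcons (h : history G) e (a z : bool) :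
  selected (rcons h (e, a, z)) = if z then e |: selected h else selected h.
Proof.
rewrite /selected filter_rcons /=; case: z => //=.
apply/setP => f; rewrite !inE.
by rewrite map_rcons mem_rcons !inE.
Qed.

(** The bias of the coin depends on the history only through its arrivals, so it is not random, and
    the activeness bit and the coin merge into one bit of bias x f * alpha. The identity is purely
    algebraic: it can be used before alpha is known to be at most 1. *)
Lemma expect_alg1_mean (R : realType) (c : R) (x pi : edge G -> R)
    (p : seq (edge G)) (h : history G) (g : {set edge G} -> R) : uniq p ->
  (forall q f, prefix (rcons q f) (arrivals h ++ p) ->
    pi f = x f * alpha c x q f) ->
  expect_from (algorithm1 c) x h p (fun h' => g (selected h'))
  = mean pi p (fun Z => g (run (selected h) p Z)).
Proof.
elim: p h => [//|e p IH] h /andP[ep up] pix.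
have arr a z : arrivals (rcons h (e, a, z)) = rcons (arrivals h) e.
  by rewrite /arrivals map_rcons.
have {}IH a z : expect_from (algorithm1 c) x (rcons h (e, a, z)) p
    (fun h' => g (selected h'))
  = mean pi p
      (fun Z => g (run (if z then e |: selected h else selected h) p Z)).
  rewrite IH // => [|q f]; first by rewrite selected_rcons.
  by rewrite arr cat_rcons; exact: pix.
have pie : pi e = x e * alpha c x (arrivals h) e.
  by apply: pix; rewrite -cat_rcons prefix_prefix.
have := algorithm1_coinE c x h e; rewrite /= => coinE.
rewrite !big_bool /= !IH coinE /alg1_accept /= andbT !andbF.
rewrite /bernoulli_pmf /= pie.
set al := alpha _ _ _ _.
rewrite (@eq_mean _ _ pi p (fun Z => g (run _ p (e |: Z)))
  (fun Z => g (run (if ~~ blocked (selected h) e then e |: selected h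
                    else selected h) p Z))); last first.
  by move=> Z; rewrite !inE eqxx /= run_setU1.
rewrite (@eq_mean _ _ pi p (fun Z => g (run _ p (Z :\ e)))
  (fun Z => g (run (selected h) p Z))); last first.
  by move=> Z; rewrite !inE eqxx /= run_setD1.
ring.
Qed.
End Run.

(** * Bipartite graphs through their endpoint maps *)

(** Endpoint maps make the two sides interchangeable: every bound proved for l transfers to r by
    [two_sidedC]. The last clause expresses that the graph is simple. *)
Definition two_sided (G : sgraph) (l r : edge G -> vtx G) : Prop :=
  [/\ forall v e, incident v e = (v == l e) || (v == r e),
      forall e f, l e != r f
    & forall e f, l e = l f -> r e = r f -> e = f].

Lemma two_sidedC (G : sgraph) (l r : edge G -> vtx G) :
  two_sided l r -> two_sided r l.
Proof.
case=> lrI lrN lrE; split=> [v e|e f|e f re le]; last exact: lrE.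
  by rewrite lrI orbC.
by rewrite eq_sym.
Qed.

Lemma bipartite_two_sided (G : sgraph) : bipartite G ->
  exists l r : edge G -> vtx G, two_sided l r.
Proof.
case=> L bip.
have lP (e : edge G) : exists u, (u \in L) && (u \in val e).
  by have [u [v [uL _ ->]]] := bip e; exists u; rewrite uL !inE eqxx.
have rP (e : edge G) : exists v, (v \notin L) && (v \in val e).
  by have [u [v [_ vL ->]]] := bip e; exists v; rewrite vL !inE eqxx orbT.
pose l e := xchoose (lP e); pose r e := xchoose (rP e).
have lL (e : edge G) : l e \in L by case/andP: (xchooseP (lP e)).
have rL (e : edge G) : r e \notin L by case/andP: (xchooseP (rP e)).
have lre (e : edge G) : val e = [set l e; r e].
  have [/andP[_]] := xchooseP (lP e); have [/andP[_]] := xchooseP (rP e).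
  rewrite -/(l e) -/(r e); have [u [v [uL vL ->]]] := bip e; rewrite !inE.
  case/orP=> /eqP re; first by move: (rL e); rewrite re uL.
  case/orP=> /eqP le; last by move: (lL e); rewrite le (negPf vL).
  by rewrite re le.
exists l, r; split=> [v e|e f|e f lef ref].
- by rewrite /incident lre !inE.
- by apply: contraNneq (rL f) => <-.
- by apply: val_inj; rewrite !lre lef ref.
Qed.

Lemma take_index_cat (T : eqType) (p1 p2 : seq T) e : uniq (p1 ++ e :: p2) ->
  take (index e (p1 ++ e :: p2)) (p1 ++ e :: p2) = p1.
Proof.
rewrite cat_uniq => /and3P[_ /= /norP[ep1 _] _].
by rewrite index_cat (negPf ep1) /= eqxx addn0 take_size_cat.
Qed.

Definition hit (G : sgraph) (k : edge G -> vtx G) (M : {set edge G})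
    (w : vtx G) : bool := [exists g in M, k g == w].

Definition mass (R : realType) (G : sgraph) (x : edge G -> R)
    (k : edge G -> vtx G) (p : seq (edge G)) (w : vtx G) : R :=
  \sum_(g <- p | k g == w) x g.

(** A matching has at most one edge at w, so being matched is linear in the indicators of the
    selected edges; [mean_hit] then only has to add up probabilities. *)
Lemma hit_sum (R : realType) (G : sgraph) (k : edge G -> vtx G)
    (M : {set edge G}) (p : seq (edge G)) (w : vtx G) :
  (forall e, incident (k e) e) -> matching M -> uniq p -> {subset M <= p} ->
  (hit k M w)%:R = \sum_(g <- p | k g == w) (g \in M)%:R :> R.
Proof.
move=> ke mM up Mp; have /card_le1_eqP Mw := mM w.
have [/existsP[g /andP[gM /eqP gw]]|nh] := boolP (hit k M w).
  rewrite big_mkcond (bigD1_seq g) ?Mp //= gw eqxx gM big1 ?addr0 // => f nfg.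
  case: eqP => // fw; case: (boolP (f \in M)) => // fM.
  case/eqP: nfg; apply: Mw; rewrite inE.
    by rewrite gM -gw ke.
  by rewrite fM -fw ke.
rewrite big1 // => g /eqP gw; case: (boolP (g \in M)) => // gM.
by case/existsP: nh; exists g; rewrite gM gw eqxx.
Qed.

Lemma blocked_hit (G : sgraph) (l r : edge G -> vtx G) M (e : edge G) :
  two_sided l r -> blocked M e = hit l M (l e) || hit r M (r e).
Proof.
case=> lrI lrN _; apply/existsP/orP.
  case=> f /andP[fM /existsP[v]]; rewrite !lrI.
  case/andP=> /orP[]/eqP-> /orP[]/eqP h.
  - by left; apply/existsP; exists f; rewrite fM h /=.
  - by case/eqP: (lrN e f).
  - by case/eqP: (lrN f e).
  - by right; apply/existsP; exists f; rewrite fM h /=.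
case=> /existsP[f /andP[fM /eqP h]]; exists f; rewrite fM /=; apply/existsP.
  by exists (l e); rewrite !lrI h eqxx.
by exists (r e); rewrite !lrI h eqxx !orbT.
Qed.

(** * Exact selection probabilities *)

Section Good.
Variables (R : realType) (G : sgraph) (c : R) (x pi : edge G -> R).
Implicit Types (p q : seq (edge G)) (e f g : edge G).

(** The invariant carried along the arrival order: pi f is a probability equal to c * x f /
    P[f not blocked], written without division. *)
Definition good p := forall p1 f p2, p = p1 ++ f :: p2 -> 0 <= pi f <= 1 /\
  pi f * mean pi p1 (fun Z => (~~ blocked (run set0 p1 Z) f)%:R) = c * x f.

Lemma good_catl p1 p2 : good (p1 ++ p2) -> good p1.
Proof.
by move=> gp q f q2 pE; apply: (gp q f (q2 ++ p2)); rewrite pE -catA.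
Qed.

Lemma good_pi01 p : good p -> {in p, forall f, 0 <= pi f <= 1}.
Proof. by move=> gp f fp; case/splitPr: fp gp => p1 p2 /(_ _ _ _ erefl)[]. Qed.

(** Selection of f means that f is in Z and is not blocked by the run on p1. The first event depends
    on f alone, the second only on the edges of p1. *)
Lemma mean_selected p f : uniq p -> good p -> f \in p ->
  mean pi p (fun Z => (f \in run set0 p Z)%:R) = c * x f.
Proof.
move=> up gp fp; have pi01 := good_pi01 gp.
case/splitPr: fp up gp pi01 => p1 p2 up gp pi01.
have [_ <-] := gp _ _ _ erefl.
have [fp1 fp2 p12] :
    [/\ f \notin p1, f \notin p2 & {in p2, forall e, e \notin p1}].
  move: up; rewrite cat_uniq /= => /and4P[_ /norP[-> /hasPn h] -> _].
  by split=> // e /h.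
rewrite (@eq_mean _ _ pi _ _ (fun Z => (f \in Z)%:R
  * (~~ blocked (run set0 p1 Z) f)%:R)); last first.
  by move=> Z; rewrite mem_run_cons // -natrM mulnb.
rewrite mean_indepM //; last first.
  move=> e _; have [->|nef] := eqVneq e f.
    by right => Z; rewrite run_setU1 // run_setD1.
  by left=> Z; rewrite !inE [f == e]eq_sym (negPf nef).
rewrite mean_mem //; last by rewrite mem_cat mem_head orbT.
rewrite mean_catl // => e; rewrite inE => e2.
have ep1 : e \notin p1 by case/orP: e2 => [/eqP->|/p12].
by move=> Z; rewrite run_setU1 // run_setD1.
Qed.

Lemma mean_hit k p w : (forall e, incident (k e) e) -> uniq p -> good p ->
  mean pi p (fun Z => (hit k (run set0 p Z) w)%:R) = c * mass x k p w.
Proof.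
move=> ke up gp.
rewrite (@eq_mean _ _ pi _ _
  (fun Z => \sum_(g <- p | k g == w) (g \in run set0 p Z)%:R)).
  rewrite mean_sum mulr_sumr big_seq_cond [RHS]big_seq_cond.
  by apply: eq_bigr => g /andP[gp' _]; exact: mean_selected.
move=> Z; apply: hit_sum => //; first exact: matching_run.
by move=> e; exact: run_mem.
Qed.

(** Inclusion-exclusion over the two endpoints of e; only the joint term is not determined by the
    marginals. *)
Lemma mean_unblocked l r p e : two_sided l r -> uniq p -> good p ->
  mean pi p (fun Z => (~~ blocked (run set0 p Z) e)%:R)
  = 1 - c * mass x l p (l e) - c * mass x r p (r e)
    + mean pi p (fun Z => (hit l (run set0 p Z) (l e)
                        && hit r (run set0 p Z) (r e))%:R).
Proof.
move=> lr up gp; have [lrI _ _] := lr.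
rewrite -!mean_hit //; try by move=> f; rewrite lrI eqxx ?orbT.
rewrite -[X in X - _ - _](mean_const pi p 1) -!meanB -meanD.
apply: eq_mean => Z; rewrite (blocked_hit _ _ lr).
by case: (hit l _ _); case: (hit r _ _); rewrite /=; ring.
Qed.
End Good.

(** * Sole edges as witnesses that a vertex is matched *)

Section Witness.
Variables (G : sgraph) (l r : edge G -> vtx G).
Implicit Types (p q : seq (edge G)) (e f g : edge G) (Z : {set edge G}).

(** Absence from Z, rather than from the selected set, makes the event depend only on the edges of q
    at w and decrease in each of them. *)
Definition free q w Z : bool := all (fun g => (r g == w) ==> (g \notin Z)) q.

Definition sole p f Z : bool :=
  (f \in Z) && free (take (index f p) p) (r f) Z.

Definition has_sole p u Z : bool :=
  has (fun f => sole p f Z) [seq f <- p | l f == u].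

Lemma free_notin q w e Z : (r e != w) || (e \notin q) ->
  (free q w (e |: Z) = free q w Z) * (free q w (Z :\ e) = free q w Z).
Proof.
move=> h; have hg g : g \in q -> r g == w -> g != e.
  by move=> gq; apply: contraTneq => ge; move: h; rewrite -ge gq orbF.
split; apply: eq_in_all => g gq; case: eqVneq => //= gw; rewrite !inE;
  by rewrite (negPf (hg g gq _)) ?gw.
Qed.

Lemma free_decr q w e Z : free q w (e |: Z) -> free q w (Z :\ e).
Proof.
apply: sub_all => g; case: eqP => //= _.
by rewrite !inE negb_or => /andP[-> /negPf->].
Qed.

Lemma sole_indep p f e Z : r e != r f -> sole p f (e |: Z) = sole p f (Z :\ e).
Proof.
move=> ref; have nef : f != e by apply: contraNneq ref => ->.
by rewrite /sole !free_notin ?ref // !inE (negPf nef).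
Qed.

Lemma sole_decr p f e Z : e != f -> sole p f (e |: Z) -> sole p f (Z :\ e).
Proof.
by move=> nef; rewrite /sole !inE eq_sym (negPf nef) /= => /andP[-> /free_decr].
Qed.

(** If f is not blocked on arrival, it is selected. If it is blocked at l f, that vertex is already
    matched. It cannot be blocked at r f: the blocking edge would be an earlier edge of Z at r f. *)
Lemma sole_hit p f Z : two_sided l r -> f \in p -> sole p f Z ->
  hit l (run set0 p Z) (l f).
Proof.
move=> lr fp /andP[fZ]; set q := take _ _ => fq.
have pE : p = q ++ f :: drop (index f p).+1 p.
  by rewrite -{1}(cat_take_drop (index f p) p) (drop_index fp).
have qR : {subset run set0 q Z <= run set0 p Z}.
  by apply/subsetP; rewrite {1}pE run_cat sub_run.
case: (boolP (blocked (run set0 q Z) f)) => [|nb]; last first.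
  apply/existsP; exists f; rewrite eqxx andbT {1}pE run_cat /= fZ nb /=.
  by apply: (subsetP (sub_run _ _ _)); rewrite setU11.
rewrite (blocked_hit _ _ lr) => /orP[]/existsP[g /andP[gR /eqP gf]].
  by apply/existsP; exists g; rewrite qR // gf /=.
have /implyP := allP fq g (run_mem gR).
by rewrite gf eqxx (subsetP (run_subset _ _) _ gR) => /(_ isT).
Qed.

Lemma has_sole_hit p u Z : two_sided l r -> has_sole p u Z ->
  hit l (run set0 p Z) u.
Proof.
move=> lr /hasP[f]; rewrite mem_filter => /andP[/eqP<- fp]; exact: sole_hit.
Qed.

Lemma has_sole_indep p u e Z : (forall f, f \in p -> l f = u -> r e != r f) ->
  has_sole p u (e |: Z) = has_sole p u (Z :\ e).
Proof.
move=> h; apply: eq_in_has => f; rewrite mem_filter => /andP[/eqP fu fp].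
by apply: sole_indep; exact: h.
Qed.

(** An edge not at u is never itself a candidate, so it enters the event only through requirements
    of absence. *)
Lemma has_sole_decr p u e Z : l e != u ->
  has_sole p u (e |: Z) -> has_sole p u (Z :\ e).
Proof.
move=> eu /hasP[f]; rewrite mem_filter => /andP[/eqP fu fp] fs.
apply/hasP; exists f; first by rewrite mem_filter fu eqxx.
by apply: sole_decr fs; apply: contraNneq eu => ->; rewrite fu.
Qed.
End Witness.

(* Lower bound for P[f in Z, and no edge of Z at r f arrives before f] / x_f. *)
Definition kappa (R : realType) (c : R) : R := c * (1 - 2 * c) / (1 - c) ^+ 2.

(** * Probability that a vertex has a sole edge *)

Section Bounds.
Variables (R : realType) (G : sgraph) (c : R) (x pi : edge G -> R).
Variables (l r : edge G -> vtx G).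
Hypotheses (lr : two_sided l r) (c01 : 0 <= c < 1 / 2).
Hypothesis x0 : forall e, 0 <= x e.
Hypothesis massl : forall q w, uniq q -> mass x l q w <= 1.
Hypothesis massr : forall q w, uniq q -> mass x r q w <= 1.
Implicit Types (p q : seq (edge G)) (e f g : edge G).

Lemma mass_ge0 k q w : 0 <= mass x k q w.
Proof. by apply: sumr_ge0. Qed.

Lemma mass_rcons k q e w :
  mass x k (rcons q e) w = mass x k q w + (if k e == w then x e else 0).
Proof. by rewrite /mass -cats1 big_cat /= [X in _ + X]big_mkcond big_seq1. Qed.

Lemma mean_unblocked_ge p e : uniq p -> good c x pi p ->
  1 - c * mass x l p (l e) - c * mass x r p (r e)
  <= mean pi p (fun Z => (~~ blocked (run set0 p Z) e)%:R).
Proof.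
move=> up gp; rewrite (mean_unblocked e lr up gp) lerDl -(mean_const pi p 0).
by apply: ler_mean => [|Z]; [exact: good_pi01 gp|exact: ler0n].
Qed.

Lemma mean_unblocked_le p e : uniq p -> good c x pi p ->
  mean pi p (fun Z => (~~ blocked (run set0 p Z) e)%:R)
  <= 1 - c * mass x r p (r e).
Proof.
move=> up gp; have [lrI _ _] := lr.
rewrite -(@mean_hit _ _ _ x pi) //; last by move=> f; rewrite lrI eqxx orbT.
rewrite -[X in X - _](mean_const pi p 1) -meanB.
apply: ler_mean => [|Z]; first exact: good_pi01 gp.
rewrite (blocked_hit _ _ lr).
by case: (hit l _ _); case: (hit r _ _); rewrite /= ?subrr ?subr0 ?ler01 ?lexx.
Qed.

(** Let D = 1 - c - c * x_q(w). A new edge g at w is unblocked with probability at least D, as x_q(l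
    g) <= 1, so pi g * D <= c * x g and D * (1 - pi g) >= D - c * x g. Thus the bound telescopes,
    starting from 1 on the empty list. *)
Lemma mean_free q w : uniq q -> good c x pi q ->
  (1 - c - c * mass x r q w) / (1 - c)
  <= mean pi q (fun Z => (free r q w Z)%:R).
Proof.
have /andP[c0 c12] := c01.
have c1 : 0 < 1 - c by lra.
elim/last_ind: q => [|q g IH].
  move=> _ _; rewrite /mass big_nil mulr0 subr0 mulfV ?lt0r_neq0 //=.
rewrite -cats1 => uq gq; have /andP[gnq uq'] : (g \notin q) && uniq q.
  by rewrite cats1 rcons_uniq in uq.
have gq' := good_catl gq; have pi01 := good_pi01 gq.
have [/andP[pig0 pig1] pig] := gq _ _ _ erefl.
have := IH uq' gq' => {}IH.
rewrite cats1 mass_rcons -cats1.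
rewrite (@eq_mean _ _ pi _ _ (fun Z => (free r q w Z)%:R
   * ((r g == w) ==> (g \notin Z))%:R)); last first.
  by move=> Z; rewrite /free all_cat /= andbT -mulnb natrM.
rewrite mean_indepM //; last first.
  move=> e _; have [->|neg] := eqVneq e g.
    by left=> Z; rewrite !free_notin ?gnq ?orbT.
  by right=> Z; rewrite !inE [g == e]eq_sym (negPf neg).
rewrite mean_catl; last first.
  by move=> e; rewrite inE => /eqP-> Z; rewrite !free_notin ?gnq ?orbT.
case: eqP => [gw|_] /=; last by rewrite mean_const mulr1 addr0.
rewrite (@eq_mean _ _ pi _ (fun Z => (g \notin Z)%:R)
  (fun Z => 1 - (g \in Z)%:R)); last first.
  by move=> Z; case: (g \in Z); rewrite /= ?subrr ?subr0.
rewrite meanB mean_const mean_mem ?mem_cat ?mem_head ?orbT //.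
have Ql := mean_unblocked_ge g uq' gq'.
have ml := massl (l g) uq; have mr := massr w uq.
rewrite cats1 !mass_rcons eqxx gw eqxx in ml mr.
rewrite gw in Ql.
set D := 1 - c - c * mass x r q w in IH *.
have D0 : 0 <= D.
  have : c * mass x r q w <= c * 1.
    by rewrite ler_wpM2l //; have := x0 g; lra.
  rewrite /D; lra.
have DQ : pi g * D <= c * x g.
  rewrite -pig ler_wpM2l //; apply: le_trans Ql.
  have : c * mass x l q (l g) <= c * 1.
    by rewrite ler_wpM2l //; have := x0 g; lra.
  rewrite /D; lra.
apply: (@le_trans _ _ (D / (1 - c) * (1 - pi g))); last first.
  by rewrite ler_wpM2r // subr_ge0.
rewrite mulrAC ler_pM2r ?invr_gt0 //.
rewrite /D in DQ *; nra.
Qed.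

Lemma kappa_ge0 : 0 <= kappa c.
Proof.
have /andP[c0 c12] := c01.
by rewrite divr_ge0 ?sqr_ge0 // mulr_ge0 //; lra.
Qed.

Lemma kappa_le : kappa c <= c.
Proof.
have /andP[c0 c12] := c01.
rewrite ler_pdivrMr; last by rewrite exprn_gt0 //; lra.
by rewrite ler_wpM2l //; have := sqr_ge0 c; lra.
Qed.

(** With y the mass at r f before f, pi f >= c * x f / (1 - c * y), and the edges before f leave r f
    free with probability at least (1 - c - c * y) / (1 - c). The product of the two bounds is
    smallest at y = 1, where it equals kappa c * x f. *)
Lemma mean_sole p f : uniq p -> good c x pi p -> f \in p ->
  kappa c * x f <= mean pi p (fun Z => (sole r p f Z)%:R).
Proof.
have /andP[c0 c12] := c01.
have c1 : 0 < 1 - c by lra.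
move=> up gp fp; case/splitPr: fp up gp => p1 p2 up gp.
have [/andP[pif0 pif1] pif] := gp _ _ _ erefl.
have gp1 := good_catl gp; have pi01 := good_pi01 gp.
have [up1 fp1 p12] :
    [/\ uniq p1, f \notin p1 & {in f :: p2, forall e, e \notin p1}].
  move: up; rewrite cat_uniq => /and3P[-> /hasPn h _]; split=> //.
  by apply: h; rewrite mem_head.
rewrite (@eq_mean _ _ pi _ _ (fun Z => (f \in Z)%:R * (free r p1 (r f) Z)%:R));
  last by move=> Z; rewrite /sole take_index_cat // -natrM mulnb.
rewrite mean_indepM //; last first.
  move=> e _; have [->|nef] := eqVneq e f.
    by right=> Z; rewrite !free_notin ?fp1 ?orbT.
  by left=> Z; rewrite !inE [f == e]eq_sym (negPf nef).
rewrite mean_mem ?mem_cat ?mem_head ?orbT // mean_catl; last first.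
  by move=> e /p12 ep Z; rewrite !free_notin ?ep ?orbT.
have F := mean_free (r f) up1 gp1.
have Q := mean_unblocked_le f up1 gp1.
have y1 := massr (r f) up1; have y0 := mass_ge0 r p1 (r f).
move: F Q y1 y0; set y := mass _ _ _ _ => F Q y1 y0.
apply: le_trans (ler_wpM2l pif0 F).
have cy : c * y <= c * 1 by rewrite ler_wpM2l.
have piy : c * x f <= pi f * (1 - c * y) by rewrite -pif ler_wpM2l.
have d0 : 0 < 1 - c * y by lra.
rewrite -(ler_pM2r d0).
(* After clearing 1 - c, the two sides differ by c^2 * (1 - y). *)
have K : (1 - 2 * c) / (1 - c) * (1 - c * y) <= 1 - c - c * y.
  rewrite mulrAC ler_pdivrMr //.
  have : 0 <= c * (c * (1 - y)) by rewrite !mulr_ge0 // subr_ge0.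
  nra.
have -> : kappa c * x f * (1 - c * y)
    = c * x f * (((1 - 2 * c) / (1 - c) * (1 - c * y)) / (1 - c)).
  by rewrite /kappa; field; lra.
have -> : pi f * ((1 - c - c * y) / (1 - c)) * (1 - c * y)
    = pi f * (1 - c * y) * ((1 - c - c * y) / (1 - c)) by ring.
apply: ler_pM => //; first by rewrite mulr_ge0.
  by rewrite divr_ge0 ?mulr_ge0 ?divr_ge0 ?invr_ge0 //; lra.
by rewrite ler_pM2r ?invr_gt0.
Qed.

Lemma mean_has_sole p u : uniq p -> good c x pi p ->
  1 - expR (- (kappa c * mass x l p u))
  <= mean pi p (fun Z => (has_sole l r p u Z)%:R).
Proof.
move=> up gp; have pi01 := good_pi01 gp; have [_ _ lrE] := lr.
(* The induction runs over the candidates q with p fixed, since [sole] refers to the position of f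
   in p. Candidates share the left endpoint u, so distinct ones have distinct right endpoints and
   independent events. *)
suff S q : uniq q -> {subset q <= p} -> (forall f, f \in q -> l f = u) ->
    mean pi p (fun Z => (~~ has (fun f => sole r p f Z) q)%:R)
    <= expR (- (kappa c * \sum_(f <- q) x f)).
  rewrite lerBlDr -lerBlDl /mass -big_filter.
  apply: le_trans (S [seq f <- p | l f == u] _ _ _).
  - rewrite -[X in X - _](mean_const pi p 1) -meanB le_eqVlt; apply/orP; left.
    apply/eqP; apply: eq_mean => Z.
    by rewrite /has_sole; case: has; rewrite /= ?subrr ?subr0.
  - by rewrite filter_uniq.
  - by move=> f; rewrite mem_filter => /andP[].
  - by move=> f; rewrite mem_filter => /andP[/eqP].
elim: q => [|f q IH] /=.
  by move=> *; rewrite big_nil mulr0 oppr0 expR0 mean_const.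
move=> /andP[fq uq] qp qu.
have fp : f \in p by apply: qp; rewrite mem_head.
rewrite (@eq_mean _ _ pi _ _ (fun Z => (~~ sole r p f Z)%:R
  * (~~ has (fun f => sole r p f Z) q)%:R)); last first.
  by move=> Z; rewrite negb_or -natrM mulnb.
rewrite mean_indepM //; last first.
  move=> e _; have [ef|nef] := eqVneq (r e) (r f); last first.
    by left=> Z; rewrite sole_indep.
  right=> Z; congr (~~ _)%:R; apply: eq_in_has => g gq; apply: sole_indep.
  rewrite ef; apply: contraNneq fq => /esym gf; rewrite -(lrE g f) //.
  by rewrite !qu // ?mem_head // inE gq orbT.
rewrite big_cons mulrDr opprD expRD; apply: ler_pM.
- rewrite -(mean_const pi p 0); apply: ler_mean => // Z; exact: ler0n.
- rewrite -(mean_const pi p 0); apply: ler_mean => // Z; exact: ler0n.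
- apply: le_trans (expR_ge1Dx _).
  rewrite (@eq_mean _ _ pi _ _ (fun Z => 1 - (sole r p f Z)%:R)); last first.
    by move=> Z; case: sole; rewrite /= ?subrr ?subr0.
  by rewrite meanB mean_const lerD2l lerN2 mean_sole.
- apply: IH => // g gq; [apply: qp|apply: qu]; by rewrite inE gq orbT.
Qed.
End Bounds.

(** * Both endpoints matched, and the resulting bound on the unblocked probability *)

Section BothMatched.
Variables (R : realType) (G : sgraph) (c : R) (x pi : edge G -> R).
Variables (l r : edge G -> vtx G).
Hypotheses (lr : two_sided l r) (c01 : 0 <= c < 1 / 2).
Hypothesis x0 : forall e, 0 <= x e.
Hypothesis massl : forall q w, uniq q -> mass x l q w <= 1.
Hypothesis massr : forall q w, uniq q -> mass x r q w <= 1.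
Implicit Types (p q : seq (edge G)) (e f g : edge G).

Lemma expR_kappa_le1 a : 0 <= a -> expR (- (kappa c * a)) <= 1.
Proof. by move=> a0; rewrite expR_le1 oppr_le0 mulr_ge0 // kappa_ge0. Qed.

Lemma mean_both p e : uniq p -> good c x pi p -> e \notin p ->
  (1 - expR (- (kappa c * mass x l p (l e))))
    * (1 - expR (- (kappa c * mass x r p (r e))))
  <= mean pi p (fun Z => (hit l (run set0 p Z) (l e)
                       && hit r (run set0 p Z) (r e))%:R).
Proof.
move=> up gp ep; have pi01 := good_pi01 gp; have [_ _ lrE] := lr.
have rl := two_sidedC lr.
have leb (b1 b2 : bool) : (b1 -> b2) -> b1%:R <= b2%:R :> R.
  by case: b1 b2 => [] [] h; rewrite ?lexx ?ler01 //; have := h isT.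
have Sl := mean_has_sole lr c01 x0 massl massr (l e) up gp.
have Sr := mean_has_sole rl c01 x0 massr massl (r e) up gp.
apply: le_trans (ler_pM _ _ Sl Sr) _.
- by rewrite subr_ge0 expR_kappa_le1 // mass_ge0.
- by rewrite subr_ge0 expR_kappa_le1 // mass_ge0.
apply: le_trans (mean_corr pi01 _) _ => [a ap|].
  (* The event for r e depends only on edges sharing a left endpoint with some f of p at r e. If
     such an edge were at l e, then f would have both endpoints of e, contradicting that e is not in
     p. The case of r e is symmetric. *)
  have [lae|lae] := eqVneq (l a) (l e).
    apply: Or33 => Z; rewrite has_sole_indep // => f fp fr.
    by apply: contraNneq ep => laf; rewrite -(lrE f e) // -laf.
  have [rae|rae] := eqVneq (r a) (r e).
    apply: Or32 => Z; rewrite has_sole_indep // => f fp fl.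
    by apply: contraNneq ep => raf; rewrite -(lrE f e) // -raf.
  by apply: Or31; split=> Z; apply: leb; exact: has_sole_decr.
apply: ler_mean => // Z; rewrite -natrM mulnb; apply: leb.
by move=> /andP[/(has_sole_hit lr)-> /(has_sole_hit rl)->].
Qed.

(** Monotonicity in the mass without derivatives: raising a to 1 increases 1 - expR (- (kappa c *
    a)) by at most kappa c * (1 - a), while it costs c * (1 - a), and kappa c <= c. *)
Lemma expR_trade a b : 0 <= a <= 1 -> 0 <= b <= 1 ->
  (1 - expR (- kappa c)) * b - c <= (1 - expR (- (kappa c * a))) * b - c * a.
Proof.
move=> /andP[a0 a1] /andP[b0 b1].
have E1 := expR_kappa_le1 a0; have E0 := expR_ge0 (- (kappa c * a)).
have k0 := kappa_ge0 c01; have kc := kappa_le c01.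
have E : expR (- (kappa c * a)) - expR (- kappa c) <= kappa c * (1 - a).
  have -> : - kappa c = - (kappa c * a) + - (kappa c * (1 - a)) by ring.
  rewrite expRD; have := expR_ge1Dx (- (kappa c * (1 - a))).
  have : 0 <= kappa c * (1 - a) by rewrite mulr_ge0 // subr_ge0.
  move: E0 E1; set A := expR _; set B := expR _; set k := kappa c * _; nra.
have : (expR (- (kappa c * a)) - expR (- kappa c)) * b <= kappa c * (1 - a) * b.
  by rewrite ler_wpM2r.
have : kappa c * (1 - a) * b <= c * (1 - a) * 1.
  apply: ler_pM => //; first by rewrite mulr_ge0 ?subr_ge0.
  by rewrite ler_wpM2r ?subr_ge0.
lra.
Qed.

Lemma unblocked_bounds p e :
  0 <= 1 - 3 * c + (1 - expR (- kappa c)) ^+ 2 ->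
  uniq p -> good c x pi p -> e \notin p ->
  let Q := mean pi p (fun Z => (~~ blocked (run set0 p Z) e)%:R) in
  0 < Q /\ c <= Q.
Proof.
move=> cond up gp ep Q; have /andP[c0 c12] := c01.
have a0 := mass_ge0 x0 l p (l e); have b0 := mass_ge0 x0 r p (r e).
have a1 := massl (l e) up; have b1 := massr (r e) up.
have Qge := mean_unblocked_ge lr e up gp.
have Qeq := mean_unblocked e lr up gp.
have both := mean_both up gp ep.
rewrite -/Q in Qge Qeq; move: both Qge Qeq a0 b0 a1 b1.
set a := mass _ _ _ _; set b := mass _ _ _ _ => both Qge Qeq a0 b0 a1 b1.
split.
  (* Positivity is proved separately, because c = 0 is allowed and then c <= Q does not give it. *)
  have : c * a <= c * 1 by rewrite ler_wpM2l.
  have : c * b <= c * 1 by rewrite ler_wpM2l.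
  lra.
have h y : 0 <= y -> 0 <= 1 - expR (- (kappa c * y)) <= 1.
  by move=> y0; rewrite subr_ge0 expR_kappa_le1 //= gerBl expR_ge0.
have a01 : 0 <= a <= 1 by rewrite a0.
have b01 : 0 <= b <= 1 by rewrite b0.
(* First a is raised to 1 with the factor of b kept, then b with the factor of a already at its
   final value. What remains is 1 - 2 * c + (1 - expR (- kappa c))^2, at least c by [cond]. *)
have T1 := expR_trade a01 (h b b0).
have := expR_trade b01 (h 1 ler01).
rewrite mulr1 => T2.
rewrite Qeq expr2 in cond *; lra.
Qed.
End BothMatched.

(** * Induction along the arrival order *)

Section Analysis.
Variables (R : realType) (G : sgraph) (c : R) (x : edge G -> R).
Variables (s : seq (edge G)).
Hypotheses (bip : bipartite G) (c01 : 0 <= c < 1 / 2).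
Hypothesis cond : 0 <= 1 - 3 * c + (1 - expR (- kappa c)) ^+ 2.
Hypotheses (fx : fractional_matching x) (so : arrival_order s).

Lemma arrival_uniq : uniq s.
Proof. by rewrite (perm_uniq so) enum_uniq. Qed.

Definition pi_of f : R := x f * alpha c x (take (index f s) s) f.

Lemma pi_ofE q f : prefix (rcons q f) s -> pi_of f = x f * alpha c x q f.
Proof.
move=> /prefixP[t st]; have := arrival_uniq; rewrite /pi_of st cat_rcons => us.
by rewrite take_index_cat.
Qed.

Lemma prob_mean p (g : pred {set edge G}) : prefix p s ->
  prob (algorithm1 c) x p (fun h => g (selected h))
  = mean pi_of p (fun Z => (g (run set0 p Z))%:R).
Proof.
move=> ps; have s0 : selected ([::] : history G) = set0.
  by apply/setP => e; rewrite !inE.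
rewrite /prob (@expect_alg1_mean _ _ c x pi_of p [::] (fun M => (g M)%:R)).
- by rewrite s0.
- have /prefixP[t st] := ps.
  by have := arrival_uniq; rewrite st cat_uniq => /and3P[].
- by move=> q f qf; apply: pi_ofE; exact: prefix_trans qf ps.
Qed.

Lemma mass_le1 k q w : (forall e, incident (k e) e) -> uniq q ->
  mass x k q w <= 1.
Proof.
move=> ke uq; have [x01 xv] := fx; apply: le_trans (xv w).
rewrite /mass -big_filter big_uniq ?filter_uniq //=.
rewrite [leLHS]big_mkcond [leRHS]big_mkcond; apply: ler_sum => e _.
rewrite mem_filter; have /andP[xe0 _] := x01 e.
by case: eqP => [<-|_]; rewrite ?ke; case: ifP.
Qed.

Lemma arrival_bounds p e : prefix (rcons p e) s -> good c x pi_of p ->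
  0 < prob_unblocked (algorithm1 c) x p e /\ alpha c x p e <= 1.
Proof.
move=> /prefixP[t st] gp; have [l [r lr]] := bipartite_two_sided bip.
have [lrI _ _] := lr; have [x01 _] := fx.
have x0 f : 0 <= x f by have /andP[] := x01 f.
have := arrival_uniq.
rewrite st cat_uniq rcons_uniq => /and3P[/andP[ep up] _ _].
have ps : prefix p s by rewrite st cat_rcons prefix_prefix.
have [||Q0 Qc] := unblocked_bounds lr c01 x0 _ _ cond up gp ep.
- by move=> q w; apply: mass_le1 => f; rewrite lrI eqxx.
- by move=> q w; apply: mass_le1 => f; rewrite lrI eqxx orbT.
have PQ : prob_unblocked (algorithm1 c) x p e
    = mean pi_of p (fun Z => (~~ blocked (run set0 p Z) e)%:R).
  exact: (prob_mean (fun M => ~~ blocked M e) ps).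
by rewrite /alpha PQ; split=> //; rewrite ler_pdivrMr // mul1r.
Qed.

(** Well-definedness and exact selection advance together: [good] on p gives, by [arrival_bounds], a
    positive denominator and alpha <= 1 for the next edge, and these yield [good] on the longer
    prefix. *)
Lemma good_prefix p : prefix p s -> good c x pi_of p.
Proof.
elim/last_ind: p => [_ [|? ?] //|p e IH pes].
have ps : prefix p s := prefix_trans (prefix_rcons _ _) pes.
have gp := IH ps; have [P0 a1] := arrival_bounds pes gp.
have /andP[c0 _] := c01; have [x01 _] := fx; have /andP[xe0 xe1] := x01 e.
move=> p1 f; case/lastP=> [|p2 g]; last first.
  by rewrite -rcons_cons -rcons_cat => /rcons_inj[pE _]; exact: gp pE.
rewrite cats1 => /rcons_inj[<- <-]; rewrite (pi_ofE pes); split.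
  have a0 : 0 <= alpha c x p e by rewrite divr_ge0 // ltW.
  by rewrite mulr_ge0 //= mulr_ile1.
rewrite -(prob_mean (fun M => ~~ blocked M e) ps) /alpha
  -/(prob_unblocked _ _ _ _).
by rewrite -mulrA divfK ?lt0r_neq0 // mulrC.
Qed.

Lemma prob_selected e :
  prob (algorithm1 c) x s (fun h => e \in selected h) = c * x e.
Proof.
rewrite (prob_mean (fun M => e \in M)) ?prefix_refl //.
apply: (@mean_selected _ _ c x).
- exact: arrival_uniq.
- exact/good_prefix/prefix_refl.
- by rewrite (perm_mem so) mem_enum.
Qed.
End Analysis.

(** * Validity of the scheme and the numerical instance *)

Lemma alg1_reachable_matching (R : realType) (c : R) (G : sgraph)
    (x : edge G -> R) h :
  reachable (algorithm1 c) x h ->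
  selected h \subset active h /\ matching (selected h).
Proof.
elim=> [|{}h e a b _ [sub mat]].
  have s0 : selected ([::] : history G) = set0.
    by apply/setP => f; rewrite !inE.
  by rewrite s0; split; [exact: sub0set|exact: matching0].
rewrite selected_rcons.
have -> : active (rcons h (e, a, accept (algorithm1 c) x h e a b))
    = if a then e |: active h else active h.
  rewrite /active filter_rcons /=; case: a => //=.
  by apply/setP => f; rewrite !inE map_rcons mem_rcons !inE.
rewrite /= /alg1_accept; case: a => //=.
case: ifP => [/andP[nb _]|_]; first by split; [exact: setUS|exact: matchingU1].
by split=> //; apply: subset_trans sub (subsetUr _ _).
Qed.

Lemma algorithm1_selectable (R : realType) (c : R) : 0 <= c <= 1 / 2 ->
  0 <= 1 - 3 * c + (1 - expR (- kappa c)) ^+ 2 ->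
  algorithm1_well_defined_on bipartite c /\
  selectable_ocrs_on bipartite c (algorithm1 c).
Proof.
move=> /andP[c0 c12] cond.
(* At c = 1 / 2, kappa vanishes and the condition would read 0 <= - 1 / 2. *)
have c01 : 0 <= c < 1 / 2.
  rewrite c0 lt_neqAle c12 andbT; apply/eqP => cE; move: cond.
  rewrite cE /kappa (_ : 1 - 2 * (1 / 2) = 0); last by lra.
  by rewrite mulr0 mul0r oppr0 expR0; lra.
have wd : algorithm1_well_defined_on bipartite c.
  move=> G x s bip fx so p e pes.
  apply: (arrival_bounds bip c01 cond fx so pes).
  apply: good_prefix => //; apply: prefix_trans pes; exact: prefix_rcons.
split=> //; split=> G x s.
  move=> h bip fx so hr hs; have [sub mat] := alg1_reachable_matching hr.
  split=> // e es; rewrite algorithm1_coinE.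
  have [P0 ->] := wd _ _ _ bip fx so _ _ es.
  by rewrite andbT divr_ge0 // ltW.
by move=> bip fx so e; rewrite (prob_selected bip c01 cond).
Qed.

Lemma condition_349 (R : realType) (c := 349 / 1000 : R) :
  0 <= 1 - 3 * c + (1 - expR (- kappa c)) ^+ 2.
Proof.
(* 16 * k = 32 / 129 lies just below kappa c, which is about 0.2487; the exponential is then bounded
   below by (1 + k)^16. *)
pose k : R := 2 / 129.
have kk : 16%:R * k <= kappa c.
  rewrite /kappa ler_pdivlMr /k /c; last by rewrite exprn_gt0 //; lra.
  by lra.
have E : (1 + k) ^+ 16 <= expR (kappa c).
  apply: (@le_trans _ _ (expR (16%:R * k))); last by rewrite ler_expR.
  rewrite expRM_natl lerXn2r ?nnegrE ?expR_ge0 ?expR_ge1Dx // /k; lra.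
(* 979 / 1250 = 1 - 271 / 1250, where 271 / 1250 = 0.2168 is just above the square root of 3 * c - 1
   = 0.047. *)
have k16 : 1250 / 979 <= (1 + k) ^+ 16 by rewrite /k; lra.
have : expR (- kappa c) <= 979 / 1250.
  rewrite expRN -[leRHS]invrK lef_pV2 ?posrE ?expR_gt0 //; last by lra.
  by apply: le_trans E; apply: le_trans k16; rewrite invf_div.
have := expR_ge0 (- kappa c); set y := expR _ => y0 y1.
have : (271 / 1250) ^+ 2 <= (1 - y) ^+ 2 by rewrite lerXn2r ?nnegrE; lra.
rewrite /c; lra.
Qed.

Theorem theorem2 (R : realType) :
  (forall c : R, 0 <= c <= 1 / 2 ->
     0 <= 1 - 3 * c
          + (1 - expR (- (c * (1 - 2 * c) / (1 - c) ^+ 2))) ^+ 2 ->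
     algorithm1_well_defined_on bipartite c /\
     selectable_ocrs_on bipartite c (algorithm1 c)) /\
  (algorithm1_well_defined_on bipartite (349 / 1000 : R) /\
   selectable_ocrs_on bipartite (349 / 1000 : R) (algorithm1 (349 / 1000 : R))).
Proof.
split=> [c|]; first exact: algorithm1_selectable.
by apply: algorithm1_selectable; [lra|exact: condition_349].
Qed.
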